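(* Let $T$ be a complete first-order theory in a language $L$. If $T$ is VC-minimal, then $T$ is convexly orderable.
   Context: $\mathfrak{C}$ denotes a monster model of $T$. ''Formula'' means an $L$-formula without parameters unless stated otherwise; $x$ denotes a single variable, $\overline{y}$ a finite tuple of variables, $\mathrm{lg}(\overline{y})$ its length, and $\varphi(M;\overline{b}) = \{a \in M : \models \varphi(a;\overline{b})\}$. Independence dimension: for a set $X$ and $\mathcal{A} \subseteq \mathcal{P}(X)$, put $B^1 = B$ and $B^0 = X \setminus B$ for $B \subseteq X$. A family $\mathcal{B} \subseteq \mathcal{P}(X)$ is independent with respect to $X$ if $\bigcap_{B \in \mathcal{B}} B^{s(B)} \neq \emptyset$ for every function $s : \mathcal{B} \to \{0,1\}$. $\mathcal{A}$ has independence dimension $N$ with respect to $X$ if $N$ is maximal such that some $\mathcal{B} \subseteq \mathcal{A}$ with $|\mathcal{B}| = N$ is independent with respect to $X$. VC-minimal: a set of formulas $\Phi = \{\varphi_i(x;\overline{y}_i) : i \in I\}$ is a VC-instantiable family if $\{\varphi_i(\mathfrak{C};\overline{b}) : i \in I, \overline{b} \in \mathfrak{C}^{\mathrm{lg}(\overline{y}_i)}\}$ has independence dimension $\le 1$ with respect to $\mathfrak{C}$. An instance of $\Phi$ is a formula $\varphi_i(x;\overline{b})$ with $i \in I$, $\overline{b} \in \mathfrak{C}^{\mathrm{lg}(\overline{y}_i)}$. $T$ is VC-minimal if there is a VC-instantiable family $\Phi$ such that every formula $\psi(x)$ with parameters from $\mathfrak{C}$ is $T$-equivalent to a boolean combination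 of instances of $\Phi$. Convexly orderable: an $L$-structure $M$ is convexly orderable if there is a linear order $<$ on $M$ (not necessarily definable) such that for every $L$-formula $\varphi(x;\overline{y})$ there is $K < \omega$ such that for all $\overline{b} \in M^{\mathrm{lg}(\overline{y})}$, $\varphi(M;\overline{b})$ is a union of at most $K$ $<$-convex subsets of $M$. A theory is convexly orderable if all of its models are. *)

(* Defs.v *)
From mathcomp Require Import all_boot.
From mathcomp Require Import boolp classical_sets functions cardinality.

Set Implicit Arguments.
Unset Strict Implicit.
Unset Printing Implicit Defensive.

Local Open Scope classical_set_scope.
Local Open Scope card_scope.

Record language := Language {
  funsym : Type;
  farity : funsym -> nat;
  relsym : Type;
  rarity : relsym -> nat }.

(** The free variables of a [term L n] or [formula L n] are indexed by ['I_n];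
    a quantifier binds the variable [ord0] of its body and shifts the others. *)
Inductive term (L : language) (n : nat) : Type :=
| Var of 'I_n
| App (f : funsym L) of ('I_(farity f) -> term L n).

Inductive formula (L : language) : nat -> Type :=
| Fbot n : formula L n
| Feq n : term L n -> term L n -> formula L n
| Frel n (r : relsym L) : ('I_(rarity r) -> term L n) -> formula L n
| Fimp n : formula L n -> formula L n -> formula L n
| Fall n : formula L n.+1 -> formula L n.

Arguments Var {L n} _.
Arguments App {L n} f _.
Arguments Fbot {L} n.
Arguments Frel {L n} r _.

Definition sentence (L : language) := formula L 0.

Definition Fnot (L : language) n (phi : formula L n) : formula L n :=
  Fimp phi (Fbot n).

Record structure (L : language) := Structure {
  dom :> Type;
  dom_inhabited : inhabited dom;
  finterp : forall f : funsym L, ('I_(farity f) -> dom) -> dom;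
  rinterp : forall r : relsym L, ('I_(rarity r) -> dom) -> Prop }.

Arguments finterp {L} s f _.
Arguments rinterp {L} s r _.

Definition scons (X : Type) n (a : X) (b : 'I_n -> X) : 'I_n.+1 -> X :=
  fun i => oapp b a (unlift ord0 i).

Definition no_var (X : Type) : 'I_0 -> X :=
  fun i => False_rect X (notF (ltn_ord i)).

Fixpoint eval (L : language) (M : structure L) n (v : 'I_n -> M)
    (t : term L n) : M :=
  match t with
  | Var i => v i
  | App f ts => finterp M f (fun j => eval v (ts j))
  end.

Fixpoint sat (L : language) (M : structure L) n (phi : formula L n) :
    ('I_n -> M) -> Prop :=
  match phi in formula _ n return ('I_n -> M) -> Prop with
  | Fbot _ => fun _ => False
  | Feq _ t u => fun v => eval v t = eval v u
  | Frel _ r ts => fun v => rinterp M r (fun j => eval v (ts j))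
  | Fimp _ phi psi => fun v => sat phi v -> sat psi v
  | Fall _ phi => fun v => forall a : M, sat phi (scons a v)
  end.

Definition holds (L : language) (M : structure L) (sigma : sentence L) : Prop :=
  sat sigma (@no_var M).

Definition model (L : language) (T : set (sentence L)) (M : structure L) :
  Prop := forall sigma, T sigma -> holds M sigma.

Definition entails (L : language) (T : set (sentence L)) (sigma : sentence L) :
  Prop := forall M : structure L, model T M -> holds M sigma.

(** Complete theories are consistent by convention. *)
Definition complete (L : language) (T : set (sentence L)) : Prop :=
  (exists M : structure L, model T M) /\
  (forall sigma : sentence L, entails T sigma \/ entails T (Fnot sigma)).

(** In a [formula L n.+1] seen as phi(x; y), the variable [ord0] is x and the
    other [n] variables form the tuple y; this is phi(M; b). *)
Definition defset (L : language) (M : structure L) n (phi : formula L n.+1)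
    (b : 'I_n -> M) : set M :=
  [set a | sat phi (scons a b)].

(** A formula over [M] in [m] variables: each free variable of [fbody] is
    either one of the [m] variables or is replaced by an element of [M]. *)
Record formula_over (L : language) (M : structure L) (m : nat) := FormulaOver {
  fvars : nat;
  fbody : formula L fvars;
  fslot : 'I_fvars -> 'I_m + M }.

Arguments fslot {L M m} f _.

Definition over_set (L : language) (M : structure L) m (A : set M)
    (f : formula_over M m) : Prop :=
  forall i c, fslot f i = inr c -> A c.

Definition sat_over (L : language) (M : structure L) m (x : 'I_m -> M)
    (f : formula_over M m) : Prop :=
  sat (fbody f) (fun i => match fslot f i with inl j => x j | inr c => c end).

Definition small (kappa : Type) (X : Type) (A : set X) : Prop :=
  ~ ([set: kappa] #<= A).

Definition saturated (L : language) (kappa : Type) (M : structure L) : Prop :=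
  forall (A : set M) (m : nat) (p : set (formula_over M m)),
    small kappa A ->
    (forall f, p f -> over_set A f) ->
    (forall q, q `<=` p -> finite_set q ->
       exists x : 'I_m -> M, forall f, q f -> sat_over x f) ->
    exists x : 'I_m -> M, forall f, p f -> sat_over x f.

Definition automorphism (L : language) (M : structure L) (g : M -> M) : Prop :=
  [/\ bijective g,
      forall (f : funsym L) (v : 'I_(farity f) -> M),
        g (finterp M f v) = finterp M f (g \o v) &
      forall (r : relsym L) (v : 'I_(rarity r) -> M),
        rinterp M r (g \o v) <-> rinterp M r v].

(** Only the values of [f] on [A] matter. *)
Definition elementary_on (L : language) (M : structure L) (A : set M)
    (f : M -> M) : Prop :=
  forall n (phi : formula L n) (v : 'I_n -> M),
    (forall i, A (v i)) -> (sat phi v <-> sat phi (f \o v)).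

Definition strongly_homogeneous (L : language) (kappa : Type)
    (M : structure L) : Prop :=
  forall (A : set M) (f : M -> M),
    small kappa A -> elementary_on A f ->
    exists2 g : M -> M, automorphism g & forall a, A a -> g a = f a.

(** A kappa-saturated, strongly kappa-homogeneous model of [T], for a cardinal
    kappa (that of the type [kappa]) which is larger than |L| + aleph_0. *)
Definition monster (L : language) (T : set (sentence L)) (kappa : Type)
    (C : structure L) : Prop :=
  [/\ small kappa [set: nat + (funsym L + relsym L)],
      model T C,
      saturated kappa C &
      strongly_homogeneous kappa C].

Definition independent (X : Type) (B : set (set X)) : Prop :=
  forall s : set X -> bool,
    \bigcap_(b in B) (if s b then b else ~` b) !=set0.

Definition has_independent (X : Type) (A : set (set X)) (N : nat) : Prop :=
  exists B : set (set X), [/\ B `<=` A, B #= `I_N & independent B].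

Definition independence_dimension (X : Type) (A : set (set X)) (N : nat) :
  Prop :=
  has_independent A N /\
  (forall N' : nat, has_independent A N' -> (N' <= N)%N).

Record partitioned_formula (L : language) := PartitionedFormula {
  plen : nat;
  pbody :> formula L plen.+1 }.

Definition instance_sets (L : language) (C : structure L)
    (Phi : set (partitioned_formula L)) : set (set C) :=
  [set D | exists2 phi, Phi phi &
             exists b : 'I_(plen phi) -> C, D = defset phi b].

Arguments instance_sets {L} C Phi.

Definition VC_instantiable (L : language) (C : structure L)
    (Phi : set (partitioned_formula L)) : Prop :=
  exists2 N : nat, (N <= 1)%N & independence_dimension (instance_sets C Phi) N.

Inductive boolean_combination (L : language) (C : structure L)
    (Phi : set (partitioned_formula L)) : Type :=
| BCinst (phi : partitioned_formula L) of Phi phi & ('I_(plen phi) -> C)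
| BCbot
| BCnot of boolean_combination C Phi
| BCand of boolean_combination C Phi & boolean_combination C Phi.

Fixpoint bc_sat (L : language) (C : structure L)
    (Phi : set (partitioned_formula L)) (beta : boolean_combination C Phi)
    (a : C) : Prop :=
  match beta with
  | BCinst phi _ b => sat phi (scons a b)
  | BCbot => False
  | BCnot beta => ~ bc_sat beta a
  | BCand beta gamma => bc_sat beta a /\ bc_sat gamma a
  end.

(** VC-minimality of the theory with monster model [C]; equivalence of formulas
    with parameters from [C] is equivalence in [C]. *)
Definition VC_minimal (L : language) (C : structure L) : Prop :=
  exists2 Phi : set (partitioned_formula L), VC_instantiable C Phi &
    forall (n : nat) (psi : formula L n.+1) (c : 'I_n -> C),
      exists beta : boolean_combination C Phi,
        forall a : C, sat psi (scons a c) <-> bc_sat beta a.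

Record linear_order (X : Type) (lt : X -> X -> Prop) : Prop := LinearOrder {
  lt_irrefl : forall a, ~ lt a a;
  lt_trans : forall a b c, lt a b -> lt b c -> lt a c;
  lt_total : forall a b, [\/ lt a b, a = b | lt b a] }.

Definition convex (X : Type) (lt : X -> X -> Prop) (D : set X) : Prop :=
  forall a b c, D a -> D c -> lt a b -> lt b c -> D b.

(** "At most [K]" is expressed by [K] sets which may repeat or be empty. *)
Definition union_of_convex (X : Type) (lt : X -> X -> Prop) (K : nat)
    (D : set X) : Prop :=
  exists F : 'I_K -> set X,
    (forall i, convex lt (F i)) /\ D = \bigcup_(i in [set: 'I_K]) F i.

Definition convexly_orderable (L : language) (M : structure L) : Prop :=
  exists2 lt : M -> M -> Prop, linear_order lt &
    forall (n : nat) (phi : formula L n.+1),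
      exists K : nat, forall b : 'I_n -> M,
        union_of_convex lt K (defset phi b).

Definition convexly_orderable_theory (L : language) (T : set (sentence L)) :
  Prop :=
  forall M : structure L, model T M -> convexly_orderable M.

(* Main.v *)
Require Import Defs.
From mathcomp Require Import all_boot.
From mathcomp Require Import boolp classical_sets functions cardinality filter.

Set Implicit Arguments.
Unset Strict Implicit.
Unset Printing Implicit Defensive.

Local Open Scope classical_set_scope.
Local Open Scope card_scope.

(** Two instances of [Phi] never cross: one of the four cells that they cut out
    of the universe is empty. This is first order, so it passes from [C] to any
    model [M] of [T]. Replacing instances in [M] by their complements so that all
    of them avoid a fixed point gives a laminar family, and a laminar family is
    convex for some linear order: on a finite set, put a maximal proper member
    before its complement and recurse; in general, take the ultraproduct of the
    orders on the finite subsets. Every instance is then a union of two convex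
    sets. Saturation of [C] yields, for each formula [phi(x; y)], finitely many
    boolean combinations [psi(x; z)] of formulas of [Phi] such that every
    [phi(x; b)] is equivalent to some [psi(x; c)] with [psi] among them; this too
    passes to [M], and bounds the number of convex pieces uniformly in [b]. *)

(** * Laminar families and linear orders *)

Definition laminar (X : Type) (A : set (set X)) : Prop :=
  forall D E, A D -> A E -> [\/ D `&` E = set0, D `<=` E | E `<=` D].

(** Points off [t] have index [size t], so the index inequalities together with [z \in t] put [x]
    and [y] in [t] too. *)
Definition seq_convex (X : eqType) (t : seq X) (D : set X) : Prop :=
  forall x y z, D x -> D z -> z \in t ->
    index x t < index y t -> index y t < index z t -> D y.

Lemma count_lt (X : eqType) (P Q : pred X) (s : seq X) y :
  subpred P Q -> y \in s -> Q y -> ~~ P y -> count P s < count Q s.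
Proof.
move=> PQ ys Qy nPy; elim: s ys => //= z s IHs; rewrite inE => /orP[/eqP <-|ys].
  by rewrite Qy (negbTE nPy) add0n add1n ltnS; apply: sub_count.
rewrite -addnS; apply: leq_add (IHs ys).
by case Pz: (P z); rewrite // (PQ _ Pz).
Qed.

Lemma laminar_arrangement (X : eqType) (A : set (set X)) (s : seq X) :
  laminar A ->
  exists2 t : seq X, t =i s & forall D, A D -> seq_convex t D.
Proof.
move=> lamA; have [n] := ubnP (size s); elim: n => // n IHn in s *.
rewrite ltnS => s_n.
pose c (D : set X) := count (mem D) s.
have cE (D E : set X) y : D `<=` E -> y \in s -> E y -> ~ D y -> c D < c E.
  move=> DE ys Ey nDy; apply: (@count_lt _ _ _ _ y) => //=.
  - by move=> x /= /set_mem/DE; apply: mem_set.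
  - exact: mem_set.
  - by apply/negP => /set_mem.
(* [P k]: some member of [A] splits [s], with [k] entries of [s] inside it. The largest such [k]
   provides the pivot [D]. *)
pose P k := `[< exists D, [/\ A D, c D = k, exists2 x, x \in s & D x
                & exists2 x, x \in s & ~ D x] >].
have [exP|noP] := pselect (exists k, P k); last first.
  (* No member splits [s], so the given arrangement works. *)
  exists s => // D AD x y z Dx Dz zs xy yz.
  have ys : y \in s by rewrite -index_mem (ltn_trans yz) ?index_mem.
  apply: contrapT => nDy; apply: noP; exists (c D); apply/asboolP; exists D.
  by split => //; [exists z | exists y].
have ubP k : P k -> k <= size s.
  by move=> /asboolP[D [_ <- _ _]]; apply: count_size.
have [k /asboolP[D [AD cD [a as_ Da] [b bs nDb]]] kmax] := ex_maxnP exP ubP.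
(* By maximality of [k], a member above [D] that still splits [s] has no further point of [s]. *)
have Dmax E y : A E -> D `<=` E -> y \in s -> ~ E y ->
    forall x, x \in s -> E x -> D x.
  move=> AE DE ys nEy x xs Ex; apply: contrapT => nDx.
  suff : c E <= k by rewrite leqNgt -cD (cE _ _ x).
  by apply/kmax/asboolP; exists E; split => //; [exists x | exists y].
have [|t1 t1s c1] := IHn [seq x <- s | x \in D].
  apply: leq_trans s_n; rewrite size_filter -count_predT.
  by apply: (@count_lt _ _ _ _ b) => //; apply/negP => /set_mem.
have [|t2 t2s c2] := IHn [seq x <- s | x \notin D].
  apply: leq_trans s_n; rewrite size_filter -count_predT.
  by apply: (@count_lt _ _ _ _ a) => //; rewrite negbK; apply: mem_set.
have m1 x : x \in t1 -> D x by rewrite t1s mem_filter => /andP[/set_mem].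
have m1' x : x \in s -> D x -> x \in t1.
  by move=> xs Dx; rewrite t1s mem_filter xs mem_set.
have ts : t1 ++ t2 =i s.
  by move=> x; rewrite mem_cat t1s t2s !mem_filter -andb_orl orbN.
have i1 x : x \in t1 -> index x (t1 ++ t2) = index x t1.
  by rewrite index_cat => ->.
have i2 x : x \notin t1 -> index x (t1 ++ t2) = size t1 + index x t2.
  by rewrite index_cat => /negbTE ->.
have down x y : index x (t1 ++ t2) < index y (t1 ++ t2) -> y \in t1 -> x \in t1.
  move=> xy y1; apply: contraTT xy => x1.
  by rewrite -leqNgt i1// i2// (leq_trans (index_size _ _)) ?leq_addr.
exists (t1 ++ t2) => // E AE x y z Ex Ez zt xy yz.
have ys : y \in s by rewrite -ts -index_mem (ltn_trans yz) ?index_mem.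
have xs : x \in s by rewrite -ts -index_mem (ltn_trans xy) ?index_mem ?ts.
have zs : z \in s by rewrite -ts.
(* If [E] misses [D], it lives in the block [t2]; if [E] is inside [D], in [t1]; each block is
   convex by induction. If [E] contains [D] but not [y], [Dmax] puts [z] in [t1], hence also the
   earlier [y], so [y] is in [D] and in [E] after all. *)
have [DE0|DE|ED] := lamA _ _ AD AE.
- have E2 u : E u -> u \notin t1.
    move=> Eu; apply/negP => /m1 Du.
    by have : (D `&` E) u by []; rewrite DE0.
  have y1 : y \notin t1 by apply: contraNN (E2 _ Ex); apply: down.
  move: xy yz; rewrite (i2 x (E2 _ Ex)) (i2 y y1) (i2 z (E2 _ Ez)) !ltn_add2l.
  by apply: (c2 E AE x y z Ex Ez); move: zt; rewrite mem_cat (negbTE (E2 _ Ez)).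
- apply: contrapT => nEy; apply: (nEy); apply/DE/m1/(down _ z) => //.
  exact: m1' zs (Dmax E y AE DE ys nEy z zs Ez).
- have z1 := m1' _ zs (ED _ Ez); have y1 := down _ _ yz z1.
  have x1 := down _ _ xy y1.
  by move: xy yz; rewrite !i1//; apply: (c1 E AE x y z).
Qed.

(** The order is decided along an ultrafilter on the finite sequences that
    contains, for each [s0], the set of sequences extending [s0] as a set. *)
Lemma laminar_order_eqType (X : eqType) (A : set (set X)) :
  laminar A ->
  exists2 lt, linear_order lt & forall D, A D -> convex lt D.
Proof.
move=> lamA.
have arr (s : seq X) : exists t : seq X,
    t =i s /\ forall D, A D -> seq_convex t D.
  by have [t] := laminar_arrangement s lamA; exists t.
have [t tP] := choice arr.
have ts s : t s =i s by have [] := tP s.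
pose F : set_system (seq X) :=
  [set P | exists s0 : seq X, forall s, {subset s0 <= s} -> P s].
have FF : ProperFilter F.
  apply: Build_ProperFilter_ex => [P [s Ps]|]; first by exists s; apply: Ps.
  split.
  - by exists [::].
  - move=> P Q [s Ps] [s' Qs']; exists (s ++ s') => r sr.
    by split; [apply: Ps|apply: Qs'] => x xs; rewrite sr// mem_cat xs ?orbT.
  - by move=> P Q PQ [s Ps]; exists s => r /Ps/PQ.
have [U [UU FU]] := ultraFilterLemma FF.
have Umem (s0 : seq X) : U [set s | {subset s0 <= s}] by apply: FU; exists s0.
pose lt x y := U [set s | index x (t s) < index y (t s)].
exists lt; first split.
- move=> x xx; have [s /=] := filter_ex xx; by rewrite ltnn.
- move=> x y z xy yz; apply: filterS (filterI xy yz) => s [/=].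
  exact: ltn_trans.
- move=> x y; have [->|xy] := eqVneq x y; first exact: Or32.
  have [?|yx] := in_ultra_setVsetC [set s | index x (t s) < index y (t s)] UU.
    exact: Or31.
  (* Absent points all share the index [size (t s)]; restricting to [s] containing [x] and [y] makes
     their indices differ. *)
  apply: Or33; apply: filterS (filterI yx (Umem [:: x; y])) => s [/= /negP + st].
  rewrite -leqNgt leq_eqVlt => /orP[/eqP/(index_inj x)|//].
  by rewrite !ts !st ?inE ?eqxx ?orbT// => /(_ isT isT) yx'; rewrite yx' eqxx in xy.
- move=> D AD x y z Dx Dz xy yz.
  have [s [[/= xys yzs] st]] := filter_ex (filterI (filterI xy yz) (Umem [:: z])).
  have [_ /(_ _ AD) cD] := tP s; apply: (cD x y z Dx Dz _ xys yzs).
  by rewrite ts st ?inE.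
Qed.

Lemma laminar_order (X : Type) (A : set (set X)) :
  laminar A ->
  exists2 lt, linear_order lt & forall D, A D -> convex lt D.
Proof. exact: (@laminar_order_eqType {classic X}). Qed.

(** * Counting convex pieces *)

Lemma union_of_convex_finType (X : Type) (lt : X -> X -> Prop) (I : finType)
    (F : I -> set X) :
  (forall i, convex lt (F i)) ->
  union_of_convex lt #|I| (\bigcup_(i in [set: I]) F i).
Proof.
move=> cF; exists (fun i => F (enum_val i)); split=> [i|]; first exact: cF.
apply/seteqP; split=> x [i _ Fx]; last by exists (enum_val i).
by exists (enum_rank i); rewrite // enum_rankK.
Qed.

Lemma union_of_convex_leq (X : Type) (lt : X -> X -> Prop) K K' (D : set X) :
  K <= K' -> union_of_convex lt K D -> union_of_convex lt K' D.
Proof.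
move=> KK' [F [cF ->]].
exists (fun i => if insub (val i) is Some j then F j else set0); split=> [i|].
  by case: insub => [j|]; [exact: cF | move=> ?].
apply/seteqP; split=> x [i _].
  by move=> Fx; exists (widen_ord KK' i); rewrite //= valK.
by case: insub => // j Fx; exists j.
Qed.

Lemma union_of_convexI (X : Type) (lt : X -> X -> Prop) K K' (D E : set X) :
  union_of_convex lt K D -> union_of_convex lt K' E ->
  union_of_convex lt (K * K') (D `&` E).
Proof.
move=> [F [cF ->]] [G [cG ->]].
have := @union_of_convex_finType X lt ('I_K * 'I_K')%type
  (fun i => F i.1 `&` G i.2).
rewrite card_prod !card_ord; set H := \bigcup_i _ => cH.
have -> : \bigcup_i F i `&` \bigcup_i G i = H.
  apply/seteqP; split=> x; first by move=> [[i _ ?] [j _ ?]]; exists (i, j).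
  by move=> [[i j] _ [? ?]]; split; [exists i | exists j].
apply: cH => i a b c [Fa Ga] [Fc Gc] ab bc.
by split; [apply: cF ab bc | apply: cG ab bc].
Qed.

Lemma union_of_convexT (X : Type) (lt : X -> X -> Prop) :
  union_of_convex lt 1 [set: X].
Proof.
exists (fun=> setT); split=> //; apply/seteqP; split=> // x _.
by exists ord0.
Qed.

Lemma union_of_convex1 (X : Type) (lt : X -> X -> Prop) (D : set X) :
  convex lt D -> union_of_convex lt 1 D.
Proof.
move=> cD; exists (fun=> D); split=> //.
by apply/seteqP; split=> [x Dx|x []//]; exists ord0.
Qed.

Lemma union_of_convexC1 (X : Type) (lt : X -> X -> Prop) (D : set X) :
  linear_order lt -> convex lt D -> union_of_convex lt 2 (~` D).
Proof.
move=> lin cD.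
(* The pieces are the strict lower bounds and the strict upper bounds of [D]. *)
exists (fun i => [set x | forall d, D d -> if i == ord0 then lt x d else lt d x]).
split=> [i a b c /= Da Dc ab bc d Dd|].
  by move: (Da d Dd) (Dc d Dd); case: ifP => _ ad cd; apply: lt_trans lin _ _ _ _ _;
    [exact: bc|exact: cd|exact: ad|exact: ab].
apply/seteqP; split=> [x /= nDx|x [i _ /=] Fx Dx]; last first.
  by have := Fx x Dx; rewrite if_same; apply: lt_irrefl lin _.
have [below|/existsNP[d /not_implyP[Dd nxd]]] :=
  pselect (forall d, D d -> lt x d); first by exists ord0.
(* Now [x] is not below [d], so it is above [d]; were it below some [e] in [D], convexity would put
   it in [D]. *)
exists ord_max => // e De /=.
have [xe|xe|//] := lt_total lin x e; last by rewrite xe in nDx.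
have [//|xd|dx] := lt_total lin x d; first by rewrite xd in nDx.
by case: nDx; apply: cD dx xe.
Qed.

(** De Morgan: the complement is an intersection of [K] sets with two pieces each. The bound is
    crude, but it depends on [K] alone. *)
Lemma union_of_convexC (X : Type) (lt : X -> X -> Prop) K (D : set X) :
  linear_order lt -> union_of_convex lt K D ->
  union_of_convex lt (2 ^ K) (~` D).
Proof.
move=> lin [F [cF ->]]; elim: K F cF => [|K IHK] F cF.
  suff -> : ~` (\bigcup_i F i) = setT by exact: union_of_convexT.
  by apply/seteqP; split=> // x _ [[]].
rewrite expnS.
have -> : ~` (\bigcup_i F i) =
    ~` F ord0 `&` ~` (\bigcup_i F (lift ord0 i)).
  apply/seteqP; split=> x.
    by move=> nF; split=> [Fx|[i _ Fx]]; apply: nF; [exists ord0|exists (lift ord0 i)].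
  move=> [nF0 nF] [i _]; case: (unliftP ord0 i) => [j ->|->] // Fx.
  by apply: nF; exists j.
by apply: union_of_convexI (IHK _ _) => //; apply: union_of_convexC1.
Qed.

(** * Variable assignments *)

Definition lift_ren m n (f : 'I_m -> 'I_n) : 'I_m.+1 -> 'I_n.+1 :=
  scons ord0 (lift ord0 \o f).

Section Environments.
Variable X : Type.

Lemma scons0 n (a : X) (v : 'I_n -> X) : scons a v ord0 = a.
Proof. by rewrite /scons unlift_none. Qed.

Lemma scons_lift n (a : X) (v : 'I_n -> X) i : scons a v (lift ord0 i) = v i.
Proof. by rewrite /scons liftK. Qed.

(** Serves twice: it takes [sat_ren] under a quantifier, and it renames the parameters of
    [phi(x; y)] while keeping x. *)
Lemma scons_comp m n (a : X) (v : 'I_n -> X) (f : 'I_m -> 'I_n) :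
  scons a v \o lift_ren f = scons a (v \o f).
Proof.
apply: funext => i; case: (unliftP ord0 i) => [j ->|->] /=.
  by rewrite /lift_ren /scons !liftK /= ?liftK.
by rewrite /lift_ren /scons !unlift_none /= ?unlift_none.
Qed.

(** The quantified block comes first in the context, as for a single variable. *)
Definition vcat k n (z : 'I_k -> X) (v : 'I_n -> X) : 'I_(k + n) -> X :=
  fun i => match fintype.split i with inl j => z j | inr j => v j end.

Lemma vcat_lshift k n (z : 'I_k -> X) (v : 'I_n -> X) :
  vcat z v \o lshift n = z.
Proof. by apply: funext => i; rewrite /vcat /= (unsplitK (inl i)). Qed.

Lemma vcat_rshift k n (z : 'I_k -> X) (v : 'I_n -> X) :
  vcat z v \o @rshift k n = v.
Proof. by apply: funext => i; rewrite /vcat /= (unsplitK (inr i)). Qed.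

Lemma vcat_eta k n (v : 'I_(k + n) -> X) :
  vcat (v \o lshift n) (v \o @rshift k n) = v.
Proof.
apply: funext => i; have [j ->|j ->] := split_ordP i.
  by rewrite -[LHS]/((vcat _ _ \o lshift _) _) vcat_lshift.
by rewrite -[LHS]/((vcat _ _ \o @rshift _ _) _) vcat_rshift.
Qed.

(** Matches one step of [Fall_block]; the type ascription relies on [k.+1 + n] and [(k + n).+1]
    being convertible. *)
Lemma vcatS k n (z : 'I_k.+1 -> X) (v : 'I_n -> X) :
  vcat z v = scons (z ord0) (vcat (z \o lift ord0) v) :> ('I_(k + n).+1 -> X).
Proof.
apply: funext => i; case: (unliftP ord0 i) => [j ->|->].
  rewrite scons_lift; have [j' ->|j' ->] := split_ordP j.
    have -> : lift ord0 (lshift n j') = lshift n (lift ord0 j') by apply: val_inj.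
    by rewrite -[LHS]/((vcat _ _ \o lshift n) _) -[RHS]/((vcat _ _ \o lshift n) _)
      !vcat_lshift.
  have -> : lift ord0 (rshift k j') = rshift k.+1 j' by apply: val_inj.
  by rewrite -[LHS]/((vcat _ _ \o @rshift _ n) _)
    -[RHS]/((vcat _ _ \o @rshift _ n) _) !vcat_rshift.
rewrite scons0; have -> : ord0 = lshift n (@ord0 k) by apply: val_inj.
by rewrite -[LHS]/((vcat _ _ \o lshift n) _) vcat_lshift.
Qed.

End Environments.

(** * Renaming, universal closure and transfer between models *)

Section Syntax.
Variable L : language.

Fixpoint ren_term m n (f : 'I_m -> 'I_n) (t : term L m) : term L n :=
  match t with
  | Var i => Var (f i)
  | App g ts => App g (fun j => ren_term f (ts j))
  end.

(** The target context [n] is quantified after [phi] because it grows under each binder. *)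
Fixpoint ren m (phi : formula L m) : forall n, ('I_m -> 'I_n) -> formula L n :=
  match phi with
  | Fbot _ => fun n _ => Fbot n
  | Feq _ t u => fun n f => Feq (ren_term f t) (ren_term f u)
  | Frel _ r ts => fun n f => Frel r (fun j => ren_term f (ts j))
  | Fimp _ phi psi => fun n f => Fimp (ren phi f) (ren psi f)
  | Fall _ phi => fun n f => Fall (ren phi (lift_ren f))
  end.

Definition Fand n (phi psi : formula L n) := Fnot (Fimp phi (Fnot psi)).
Definition Fex n (phi : formula L n.+1) := Fnot (Fall (Fnot phi)).

Fixpoint Fall_block k n : formula L (k + n) -> formula L n :=
  match k with
  | 0 => id
  | k.+1 => fun phi => Fall_block (Fall phi)
  end.

(** Renaming along [lshift n 0] moves [phi] into the context [n + 0] that [Fall_block] expects. *)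
Definition universal_closure n (phi : formula L n) : sentence L :=
  Fall_block (ren phi (@lshift n 0)).

Variable M : structure L.

Lemma eval_ren m n (f : 'I_m -> 'I_n) (t : term L m) (v : 'I_n -> M) :
  eval v (ren_term f t) = eval (v \o f) t.
Proof.
by elim: t => //= g ts IHts; congr finterp; apply: funext => j; apply: IHts.
Qed.

Lemma sat_ren m (phi : formula L m) n (f : 'I_m -> 'I_n) (v : 'I_n -> M) :
  sat (ren phi f) v = sat phi (v \o f).
Proof.
elim: phi n f v => //= {m}.
- by move=> m t u n f v; rewrite !eval_ren.
- move=> m r ts n f v; congr rinterp; apply: funext => j; exact: eval_ren.
- by move=> m phi IHphi psi IHpsi n f v; rewrite IHphi IHpsi.
- move=> m phi IHphi n f v; apply: eq_forall => a.
  by rewrite IHphi scons_comp.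
Qed.

Lemma sat_not n (phi : formula L n) (v : 'I_n -> M) :
  sat (Fnot phi) v = ~ sat phi v.
Proof. by []. Qed.

Lemma sat_and n (phi psi : formula L n) (v : 'I_n -> M) :
  sat (Fand phi psi) v = (sat phi v /\ sat psi v).
Proof.
apply/propext; split=> [/=|[? ?]]; last by apply.
by move=> /not_implyP[? /contrapT].
Qed.

Lemma sat_ex n (phi : formula L n.+1) (v : 'I_n -> M) :
  sat (Fex phi) v = exists a, sat phi (scons a v).
Proof.
apply/propext; split=> [/=/existsNP[a /contrapT]|[a phia] /(_ a)]; last exact.
by exists a.
Qed.

Lemma sat_all_block k n (phi : formula L (k + n)) (v : 'I_n -> M) :
  sat (Fall_block phi) v = forall z : 'I_k -> M, sat phi (vcat z v).
Proof.
apply/propext; elim: k => [|k IHk] in phi *.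
  have E (z : 'I_0 -> M) : vcat z v = v.
    by apply: funext => i; rewrite -{2}(vcat_rshift z v); congr vcat; apply: val_inj.
  by split=> [? z|/(_ (@no_var M))]; rewrite E.
rewrite /= IHk /=; split=> [H z|H z a]; first by rewrite vcatS; apply: H.
have := H (scons a z); rewrite vcatS scons0.
by have -> : scons a z \o lift ord0 = z
  by apply: funext => i; rewrite /= scons_lift.
Qed.

Lemma holds_universal_closure n (phi : formula L n) :
  holds M (universal_closure phi) = forall v : 'I_n -> M, sat phi v.
Proof.
rewrite /holds sat_all_block; apply: eq_forall => v.
by rewrite sat_ren vcat_lshift.
Qed.

End Syntax.

(** [T] decides the universal closure of [phi], and the model [C] excludes the negative answer. *)
Lemma complete_transfer (L : language) (T : set (sentence L))
    (C M : structure L) n (phi : formula L n) :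
  complete T -> model T C -> model T M ->
  (forall v : 'I_n -> C, sat phi v) -> forall v : 'I_n -> M, sat phi v.
Proof.
move=> [_ cT] TC TM; rewrite -!holds_universal_closure => Cphi.
have [Tphi|Tnphi] := cT (universal_closure phi); first exact: Tphi.
by have := Tnphi C TC Cphi.
Qed.

(** * First-order forms of the properties to transfer *)

Section MoreFormulas.
Variable L : language.

Definition Fiff n (phi psi : formula L n) := Fand (Fimp phi psi) (Fimp psi phi).

Definition Fbig_or (I : Type) n (s : seq I) (theta : I -> formula L n) :=
  foldr (fun i phi => Fimp (Fnot (theta i)) phi) (Fbot n) s.

(** In the free variables y: there is z such that phi(x; y) and psi(x; z) agree for all x. *)
Definition Fsame_set m n (phi : formula L m.+1) (psi : formula L n.+1) :
    formula L m :=
  Fnot (@Fall_block L n m (Fnot (Fall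
    (Fiff (ren phi (lift_ren (@rshift n m)))
          (ren psi (lift_ren (@lshift n m))))))).

(** All four cells of the Venn diagram of phi(x; y) and psi(x; z) are inhabited. *)
Definition Fcross m n (phi : formula L m.+1) (psi : formula L n.+1) :
    formula L (m + n) :=
  let phi' := ren phi (lift_ren (@lshift m n)) in
  let psi' := ren psi (lift_ren (@rshift m n)) in
  Fand (Fand (Fex (Fand phi' psi')) (Fex (Fand phi' (Fnot psi'))))
       (Fand (Fex (Fand (Fnot phi') psi')) (Fex (Fand (Fnot phi') (Fnot psi')))).

Variable M : structure L.

Lemma sat_iff n (phi psi : formula L n) (v : 'I_n -> M) :
  sat (Fiff phi psi) v = (sat phi v <-> sat psi v).
Proof. by rewrite /Fiff sat_and; apply/propext; split=> [[]|[]]. Qed.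

Lemma sat_big_or (I : eqType) n (s : seq I) (theta : I -> formula L n)
    (v : 'I_n -> M) :
  sat (Fbig_or s theta) v = exists2 i, i \in s & sat (theta i) v.
Proof.
apply/propext; elim: s => [|i s IHs]; first by split=> // -[].
rewrite /= -/(Fbig_or s theta) IHs; split=> [H|[j]].
  have [?|/H[j js ?]] := pselect (sat (theta i) v).
    by exists i; rewrite ?mem_head.
  by exists j; rewrite // inE js orbT.
by rewrite inE => /predU1P[->|js] ? // _; exists j.
Qed.

Lemma defset_ren m n (phi : formula L m.+1) (f : 'I_m -> 'I_n) (v : 'I_n -> M) :
  defset (ren phi (lift_ren f)) v = defset phi (v \o f).
Proof. by apply: funext => a; rewrite /defset /= sat_ren scons_comp. Qed.

Lemma defset_and n (phi psi : formula L n.+1) (v : 'I_n -> M) :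
  defset (Fand phi psi) v = defset phi v `&` defset psi v.
Proof. by apply: funext => a; apply: sat_and. Qed.

Lemma sat_ex_defset n (phi : formula L n.+1) (v : 'I_n -> M) :
  sat (Fex phi) v = (defset phi v !=set0).
Proof. exact: sat_ex. Qed.

Lemma sat_same_set m n (phi : formula L m.+1) (psi : formula L n.+1)
    (v : 'I_m -> M) :
  sat (Fsame_set phi psi) v =
  exists z : 'I_n -> M, defset phi v = defset psi z.
Proof.
rewrite sat_not sat_all_block.
set body := Fiff _ _.
have E z a : sat body (scons a (vcat z v)) = (defset phi v a <-> defset psi z a).
  by rewrite sat_iff !sat_ren !scons_comp vcat_lshift vcat_rshift.
apply/propext; split=> [/existsNP[z /contrapT H]|[z eqz] /(_ z)]; last first.
  apply=> a; suff: sat body (scons a (vcat z v)) by [].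
  by rewrite E eqz.
by exists z; apply: funext => a; apply/propext; rewrite -E; apply: H.
Qed.

Definition crossing (X : Type) (D E : set X) : Prop :=
  (D `&` E !=set0 /\ D `&` ~` E !=set0) /\
  (~` D `&` E !=set0 /\ ~` D `&` ~` E !=set0).

Lemma sat_cross m n (phi : formula L m.+1) (psi : formula L n.+1)
    (b : 'I_m -> M) (c : 'I_n -> M) :
  sat (Fcross phi psi) (vcat b c) = crossing (defset phi b) (defset psi c).
Proof.
rewrite /Fcross !sat_and !sat_ex_defset !defset_and.
set phi' := ren phi _; set psi' := ren psi _.
rewrite -[defset (Fnot phi') _]/(~` defset phi' _).
rewrite -[defset (Fnot psi') _]/(~` defset psi' _).
by rewrite !defset_ren vcat_lshift vcat_rshift.
Qed.

End MoreFormulas.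

(** * Crossing pairs and independence dimension *)

Lemma crossingCl (X : Type) (D E : set X) : crossing (~` D) E -> crossing D E.
Proof. by rewrite /crossing setCK => -[]. Qed.

Lemma crossingCr (X : Type) (D E : set X) : crossing D (~` E) -> crossing D E.
Proof. by rewrite /crossing setCK => -[[? ?] [? ?]]. Qed.

(** A crossing pair is independent of size two: points of the four cells realise the four sign
    patterns, and a point of [E] outside [D] shows that the sets differ. *)
Lemma VC_instantiable_not_crossing (L : language) (C : structure L)
    (Phi : set (partitioned_formula L)) (D E : set C) :
  VC_instantiable C Phi -> instance_sets C Phi D -> instance_sets C Phi E ->
  ~ crossing D E.
Proof.
move=> [N N1 [_ maxN]] ID IE [[[x [Dx Ex]] [y [Dy nEy]]] [[z [nDz Ez]] [t [nDt nEt]]]].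
have : 2 <= N; last by rewrite leqNgt ltnS N1.
apply: maxN; exists [set D; E]; split; first by move=> F [->|->].
  apply/eq_cardSP; exists D; first by left.
  have -> : [set D; E] `\` [set D] = [set E]; last exact: card_set1.
  apply/seteqP; split=> [F [[|]] //|F ->]; split; first by right.
  by move=> /= ED; apply: nDz; rewrite -ED.
move=> s; case sD: (s D); case sE: (s E);
  by [exists x => F [|] -> /=; rewrite ?sD ?sE
     |exists y => F [|] -> /=; rewrite ?sD ?sE
     |exists z => F [|] -> /=; rewrite ?sD ?sE
     |exists t => F [|] -> /=; rewrite ?sD ?sE].
Qed.

Lemma uncrossing_order (X : Type) (p : X) (A : set (set X)) :
  (forall D E, A D -> A E -> ~ crossing D E) ->
  exists2 lt, linear_order lt & forall D, A D -> union_of_convex lt 2 D.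
Proof.
move=> nc.
have ncB D E : A D \/ A (~` D) -> A E \/ A (~` E) -> ~ crossing D E.
  move=> AD AE DE; case: AD AE => AD [] AE; apply: (nc _ _ AD AE) => //.
  - by apply: crossingCr; rewrite setCK.
  - by apply: crossingCl; rewrite setCK.
  - by apply/crossingCl/crossingCr; rewrite !setCK.
have [D E|lt lin cvx] :=
    @laminar_order X [set D | ~ D p /\ (A D \/ A (~` D))].
  move=> [nDp AD] [nEp AE]; apply: contrapT => nl; apply: (ncB _ _ AD AE).
  (* The point [p] fills the cell outside both sets, so one of the other three is empty; these are
     the three cases of [laminar]. *)
  split; split; last by exists p.
  - by apply/set0P/eqP => ?; apply: nl; apply: Or31.
  - apply: contrapT => DE; apply: nl; apply: Or32 => x Dx.
    by apply: contrapT => nEx; apply: DE; exists x.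
  - apply: contrapT => ED; apply: nl; apply: Or33 => x Ex.
    by apply: contrapT => nDx; apply: ED; exists x.
(* A set through [p] is the complement of a convex set, whence the two pieces. *)
exists lt => // D AD; have [Dp|nDp] := pselect (D p).
  rewrite -[D]setCK; apply: union_of_convexC1 => //; apply: cvx.
  by split; [apply | right; rewrite setCK].
apply: union_of_convex_leq (union_of_convex1 _) => //.
by apply: cvx; split=> //; left.
Qed.

(** * Compactness and uniform bounds *)

(** The parameter set is empty, so no bound on the cardinality of [I] is needed. *)
Lemma saturated_compactness (L : language) (kappa : Type) (C : structure L)
    (I : eqType) (P : I -> Prop) n (theta : I -> formula L n) :
  small kappa (@set0 C) -> saturated kappa C ->
  (forall b : 'I_n -> C, exists2 i, P i & sat (theta i) b) ->
  exists2 s : seq I, (forall i, i \in s -> P i) &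
    forall b : 'I_n -> C, exists2 i, i \in s & sat (theta i) b.
Proof.
move=> small0 satC cover; apply: contrapT => nofin.
(* Without a finite subcover the negations of the [theta i] form a finitely satisfiable type; its
   realisation would be uncovered. *)
pose h i : formula_over C n := FormulaOver (Fnot (theta i)) inl.
have [||x px] := satC set0 n (h @` P) small0.
- by move=> f [i Pi <-].
- move=> q qP /(@finite_seqP {classic formula_over C n})[fs qE].
  have [s sP qs] : exists2 s : seq I, (forall i, i \in s -> P i) &
      forall f, q f -> exists2 i, i \in s & h i = f.
    move: qP; rewrite {}qE; elim: fs => [|f fs IHfs] qP.
      by exists [::] => // f.
    have [i Pi hi] := qP f (mem_head _ _).
    have [|s sP qs] := IHfs.
      by move=> g gs; apply: qP; rewrite /= inE [g \in _]gs orbT.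
    exists (i :: s) => [j|g /=]; first by rewrite inE => /predU1P[->|/sP].
    rewrite inE => /predU1P[->|/qs[j js hj]]; first by exists i; rewrite ?mem_head.
    by exists j; rewrite // inE js orbT.
  apply: contrapT => nx; apply: nofin; exists s => // b.
  apply: contrapT => nb; apply: nx; exists b => f /qs[i si <-] bi.
  by apply: nb; exists i.
have [i Pi] := cover x; exact: (px (h i)).
Qed.

(** Smallness of the empty set means that [kappa] is inhabited, as smallness of any set forces. *)
Lemma small_set0 (kappa X Y : Type) (A : set X) :
  small kappa A -> small kappa (@set0 Y).
Proof. by move=> sA k0; apply: sA; apply: (card_le_trans k0); apply: card_ge0. Qed.

(** Turning the parameters of [beta] into variables gives one formula [psi], which can be read in
    both structures: in [C] it recovers [beta], in [M] its instances have a bound fixed by the shape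
    of [beta]. Conjunction concatenates the parameter tuples. *)
Lemma boolean_combination_uniform (L : language) (C M : structure L)
    (lt : M -> M -> Prop) (Phi : set (partitioned_formula L)) :
  linear_order lt ->
  (forall D, instance_sets M Phi D -> union_of_convex lt 2 D) ->
  forall beta : boolean_combination C Phi,
  exists2 psi : partitioned_formula L,
    exists K, forall z : 'I_(plen psi) -> M,
      union_of_convex lt K (defset psi z) &
    exists z : 'I_(plen psi) -> C, [set a | bc_sat beta a] = defset psi z.
Proof.
move=> lin cvx; elim=> [phi Pphi b||beta|beta].
- exists phi; last by exists b.
  by exists 2 => z; apply: cvx; exists phi => //; exists z.
- exists (@PartitionedFormula L 0 (Fbot 1)); last by exists (@no_var C).
  by exists 1 => z; apply: union_of_convex1 => a c d [].
- move=> [psi [K cK] [z Ez]]; exists (@PartitionedFormula L _ (Fnot psi)).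
    by exists (2 ^ K) => w; apply: union_of_convexC lin (cK w).
  by exists z; rewrite -[RHS]/(~` defset psi z) -Ez.
- move=> [psi [K cK] [z Ez]] gamma [psi' [K' cK'] [z' Ez']].
  exists (@PartitionedFormula L (plen psi + plen psi')
    (Fand (ren psi (lift_ren (@lshift _ _))) (ren psi' (lift_ren (@rshift _ _))))).
    exists (K * K') => w; rewrite defset_and !defset_ren.
    exact: union_of_convexI (cK _) (cK' _).
  exists (vcat z z').
  by rewrite defset_and !defset_ren vcat_lshift vcat_rshift -Ez -Ez'.
Qed.

Theorem theorem2p4 (L : language) (T : set (sentence L)) (hT : complete T)
    (kappa : Type) (C : structure L) (hC : monster T kappa C) :
  VC_minimal C -> convexly_orderable_theory T.
Proof.
move=> [Phi vcPhi bcPhi] M TM; have [sk TC satC _] := hC.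
have [p] := dom_inhabited M.
have [_ _ [phi Pphi [b ->]] [psi Ppsi [c ->]]|lt lin cvx] :=
    @uncrossing_order M p (instance_sets M Phi).
  (* Non-crossing of instances holds in [C] by VC-minimality and transfers to [M]. *)
  rewrite -sat_cross -sat_not; apply: (complete_transfer hT TC TM) => v.
  rewrite -(vcat_eta v) sat_not sat_cross.
  by apply: (VC_instantiable_not_crossing vcPhi); [exists phi|exists psi];
    rewrite //; eexists.
exists lt => // n phi.
(* [good] is a condition on [M], while the cover by good formulas is found in [C]. *)
pose good (psi : {classic partitioned_formula L}) := exists K,
  forall z : 'I_(plen psi) -> M, union_of_convex lt K (defset psi z).
have [|s sgood cover] := @saturated_compactness L kappa C
    {classic partitioned_formula L} good n
    (fun psi => Fsame_set phi psi) (small_set0 sk) satC.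
  move=> b; have [beta Ebeta] := bcPhi n phi b.
  have [psi gpsi [z Ez]] := boolean_combination_uniform lin cvx beta.
  exists psi => //; rewrite sat_same_set; exists z; rewrite -Ez.
  by apply: funext => a; apply/propext/Ebeta.
have [K sK] : exists K, forall psi, psi \in s ->
    forall z : 'I_(plen psi) -> M, union_of_convex lt K (defset psi z).
  elim: s sgood {cover} => [|psi s IHs] sgood; first by exists 0.
  have [K psiK] := sgood psi (mem_head _ _).
  have [|K' sK'] := IHs.
    by move=> chi chis; apply: sgood; rewrite inE chis orbT.
  exists (maxn K K') => chi; rewrite inE => /predU1P[->|chis] z.
    exact: union_of_convex_leq (leq_maxl _ _) (psiK z).
  exact: union_of_convex_leq (leq_maxr _ _) (sK' chi chis z).
exists K => b.
(* The finite disjunction over [s] holds throughout [C], hence at [b] in [M], where each disjunct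
   gives at most [K] pieces. *)
have := complete_transfer (phi := Fbig_or s (fun psi => Fsame_set phi psi))
  hT TC TM _ b.
rewrite sat_big_or; case=> [v|psi psis]; first by rewrite sat_big_or.
by rewrite sat_same_set => -[z ->]; apply: sK.
Qed.
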